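(* For all $n\ge0$ the bi-orthogonal polynomials of the deformed Cauchy-Laguerre system satisfy, with $x$, $y$ held fixed, $$\partial_{s} P_{n}(x) = \xi s^{a}e^{-s} P_{n}(s) \left[ \tfrac{1}{2}P_{n}(x)Q^{(1)}_{n}(-s) + K^{0,1}_{n-1}(x,-s) \right],$$ $$\partial_{s} Q_{n}(y) = \xi s^{a}e^{-s} Q^{(1)}_{n}(-s) \left[ \tfrac{1}{2}P_{n}(s)Q_{n}(y) + K^{0,0}_{n-1}(s,y) \right],$$ $$\partial_{t} P_{n}(x) = \psi t^{b}e^{-t} P^{(1)}_{n}(-t) \left[ \tfrac{1}{2}P_{n}(x)Q_{n}(t) + K^{0,0}_{n-1}(x,t) \right],$$ $$\partial_{t} Q_{n}(y) = \psi t^{b}e^{-t} Q_{n}(t) \left[ \tfrac{1}{2}P^{(1)}_{n}(-t)Q_{n}(y) + K^{1,0}_{n-1}(-t,y) \right].$$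
   Context: Fix $a,b,\xi,\psi\in\mathbb C$ with $\Re a,\Re b>-1$. For $s,t>0$ put $w_1(x)=(1-\xi\chi_{x>s})x^ae^{-x}$, $w_2(y)=(1-\psi\chi_{y>t})y^be^{-y}$ on $(0,\infty)$, $\langle f,g\rangle=\int_0^\infty\int_0^\infty\frac{w_1(x)w_2(y)}{x+y}f(x)g(y)\,dx\,dy$, $M_{j,k}=\langle x^j,y^k\rangle$, $Z_0=1$, $Z_n=\det(M_{j,k})_{0\le j,k\le n-1}$. $P_n,Q_n$ are polynomials of degree $n$ with the same leading coefficient $S_n$ ($S_n^2=Z_n/Z_{n+1}$, branch chosen differentiably in $(s,t)$) and $\langle P_m,Q_n\rangle=\delta_{m,n}$; they depend on $(s,t)$ ranging over an open set on which the standing generic conditions hold: all $M_{j,k}$ finite (absolutely convergent), $Z_n\ne0$, and $\int w_1P_n\ne0$, $\int w_2Q_n\neq0$ for all $n\ge0$. $P^{(1)}_n(z)=\int_0^\infty\frac{w_1(x)}{z-x}P_n(x)\,dx$, $Q^{(1)}_n(z)=\int_0^\infty\frac{w_2(y)}{z-y}Q_n(y)\,dy$. $K^{0,0}_n(x,y)=\sum_{l=0}^nP_l(x)Q_l(y)$, $K^{0,1}_n(x,y)=\sum_{l=0}^nP_l(x)Q^{(1)}_l(y)$, $K^{1,0}_n(x,y)=\sum_{l=0}^nP^{(1)}_l(x)Q_l(y)$ (empty sums, for index $-1$, are $0$). *)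

(* Defs.v *)
From HB Require Import structures.
From mathcomp Require Import all_boot all_order all_algebra.
From mathcomp Require Import complex.
From mathcomp Require Import all_classical all_reals all_analysis.
Set Implicit Arguments.
Unset Strict Implicit.
Unset Printing Implicit Defensive.
Import Order.TTheory GRing.Theory Num.Theory.
Import numFieldNormedType.Exports.
Local Open Scope classical_set_scope.
Local Open Scope ring_scope.
Local Open Scope complex_scope.

(* The analysis library has no normed-module structure over R on R[i]: complex
   integrability, integrals and derivatives in a real variable are taken on
   the real and imaginary parts.  Lebesgue integrability of both parts is
   absolute convergence of the complex integral. *)
Definition cintegrable (R : realType) (d : measure_display)
    (T : measurableType d) (mu : {measure set T -> \bar R}) (D : set T)
    (f : T -> R[i]) : Prop :=
  mu.-integrable D (fun x => (complex.Re (f x))%:E) /\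
  mu.-integrable D (fun x => (complex.Im (f x))%:E).

Definition cintegral (R : realType) (d : measure_display)
    (T : measurableType d) (mu : {measure set T -> \bar R}) (D : set T)
    (f : T -> R[i]) : R[i] :=
  (\int[mu]_(x in D) complex.Re (f x)) +i* (\int[mu]_(x in D) complex.Im (f x)).

Definition is_cderive (R : realType) (f : R -> R[i]) (x : R) (df : R[i]) :
    Prop :=
  is_derive x 1 (fun u : R => complex.Re (f u)) (complex.Re df) /\
  is_derive x 1 (fun u : R => complex.Im (f u)) (complex.Im df).

Definition cdifferentiable2 (R : realType) (f : R -> R -> R[i]) (s t : R) :
    Prop :=
  differentiable (fun p : R * R => complex.Re (f p.1 p.2)) (s, t) /\
  differentiable (fun p : R * R => complex.Im (f p.1 p.2)) (s, t).

(* x ^ c = exp (c * ln x), meaningful for x > 0 *)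
Definition cpow (R : realType) (x : R) (c : R[i]) : R[i] :=
  (x `^ complex.Re c * cos (complex.Im c * ln x)) +i*
  (x `^ complex.Re c * sin (complex.Im c * ln x)).

Definition laguerre_weight (R : realType) (c : R[i]) (x : R) : R[i] :=
  cpow x c * (expR (- x))%:C.

(* w_1 = deformed_weight a xi s and w_2 = deformed_weight b psi t *)
Definition deformed_weight (R : realType) (c theta : R[i]) (u x : R) : R[i] :=
  (1 - theta * (u < x)%R%:R) * laguerre_weight c x.

Definition half_line (R : realType) : set R := [set x | 0 < x].

Definition quadrant (R : realType) : set (R * R) :=
  [set p | 0 < p.1 /\ 0 < p.2].

Definition pairing_integrand (R : realType) (w1 w2 : R -> R[i])
    (f g : R -> R[i]) (p : R * R) : R[i] :=
  w1 p.1 * w2 p.2 / (p.1 + p.2)%:C * f p.1 * g p.2.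

Definition pairing_converges (R : realType) (w1 w2 : R -> R[i])
    (f g : R -> R[i]) : Prop :=
  cintegrable (lebesgue_measure \x lebesgue_measure)%E (@quadrant R)
    (pairing_integrand w1 w2 f g).

Definition pairing (R : realType) (w1 w2 : R -> R[i]) (f g : R -> R[i]) :
    R[i] :=
  cintegral (lebesgue_measure \x lebesgue_measure)%E (@quadrant R)
    (pairing_integrand w1 w2 f g).

Definition real_monomial (R : realType) (j : nat) (x : R) : R[i] := x%:C ^+ j.

Definition real_eval (R : realType) (p : {poly R[i]}) (x : R) : R[i] :=
  p.[x%:C].

Definition bimoment (R : realType) (w1 w2 : R -> R[i]) (j k : nat) : R[i] :=
  pairing w1 w2 (real_monomial (R := R) j) (real_monomial (R := R) k).

(* for n = 0 the determinant of the empty matrix is 1 *)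
Definition bimoment_det (R : realType) (w1 w2 : R -> R[i]) (n : nat) : R[i] :=
  \det (\matrix_(j < n, k < n) bimoment w1 w2 j k).

Definition weighted_integral (R : realType) (w : R -> R[i]) (p : {poly R[i]}) :
    R[i] :=
  cintegral lebesgue_measure (@half_line R) (fun x => w x * p.[x%:C]).

(* p |-> p^(1), i.e. P_n^(1) for w = w_1, p = P_n and Q_n^(1) for w = w_2,
   p = Q_n *)
Definition cauchy_transform (R : realType) (w : R -> R[i]) (p : {poly R[i]})
    (z : R[i]) : R[i] :=
  cintegral lebesgue_measure (@half_line R)
    (fun x => w x / (z - x%:C) * p.[x%:C]).

(* \sum_(0 <= l <= n) F l (x) G l (y); the index n is an integer so that
   n = -1 is allowed and gives the empty sum *)
Definition kernel_sum (R : realType) (F G : nat -> R[i] -> R[i]) (n : int)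
    (x y : R[i]) : R[i] :=
  if n is Posz m then \sum_(0 <= l < m.+1) F l x * G l y else 0.

Definition K00 (R : realType) (P Q : nat -> {poly R[i]}) :=
  kernel_sum (fun l x => (P l).[x]) (fun l y => (Q l).[y]).

Definition K01 (R : realType) (w2 : R -> R[i]) (P Q : nat -> {poly R[i]}) :=
  kernel_sum (fun l x => (P l).[x]) (fun l y => cauchy_transform w2 (Q l) y).

Definition K10 (R : realType) (w1 : R -> R[i]) (P Q : nat -> {poly R[i]}) :=
  kernel_sum (fun l x => cauchy_transform w1 (P l) x) (fun l y => (Q l).[y]).

(* Main.v *)
Require Import Defs.
From HB Require Import structures.
From mathcomp Require Import all_boot all_order all_algebra.
From mathcomp Require Import complex.
From mathcomp Require Import all_classical all_reals all_analysis.
From mathcomp Require Import measurable_realfun ring lra.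
Import Order.TTheory GRing.Theory Num.Theory.
Import numFieldNormedType.Exports.
Local Open Scope classical_set_scope.
Local Open Scope ring_scope.
Local Open Scope complex_scope.
Set Implicit Arguments.
Unset Strict Implicit.

(* The moments depend on s only through the jump of w_1, so the derivative of
   M_{j,k} in s is the rank one array xi s^a e^{-s} s^j \int w_2(y) y^k/(s+y) dy
   (Fubini, then the fundamental theorem of calculus; the inner integral is
   continuous in s).  The coefficients of P_n and Q_n are differentiable by
   Cramer's rule, and differentiating <P_n, Q_l> = delta_{n,l} yields the
   coordinates of the derivative of P_n in the basis P_0, ..., P_n.  Transposing
   the moment matrix gives Q_n, exchanging the two variables gives t. *)

(** * Derivatives of complex-valued functions of a real variable *)

(** Integrals enter only through single moments; all that concerns [P n] and [Q n] is algebra on the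
    array of moments. Analytically, the delicate point is that Fubini's theorem controls the inner
    integral at almost every [x], whereas the derivative takes its value exactly at [x = s]. The gap
    is closed by comparing the kernels [1 / (x0 + y)] and [1 / (x + y)], whose quotient is bounded
    in [y > 0]. As for signs, differentiating the orthogonality relations produces a minus sign, and
    the Cauchy transform at [- s] is minus the integral against [1 / (s + y)]; the two cancel, which
    is why the final formulas carry no sign. *)

Lemma ReM (R : realType) (z w : R[i]) : complex.Re (z * w) =
  complex.Re z * complex.Re w - complex.Im z * complex.Im w.
Proof. by case: z w => [? ?] [? ?]. Qed.

Lemma ImM (R : realType) (z w : R[i]) : complex.Im (z * w) =
  complex.Re z * complex.Im w + complex.Im z * complex.Re w.
Proof. by case: z w => [? ?] [? ?]. Qed.

Lemma ReD (R : realType) (z w : R[i]) :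
  complex.Re (z + w) = complex.Re z + complex.Re w.
Proof. by case: z w => [? ?] [? ?]. Qed.

Lemma ImD (R : realType) (z w : R[i]) :
  complex.Im (z + w) = complex.Im z + complex.Im w.
Proof. by case: z w => [? ?] [? ?]. Qed.

Lemma is_cderive_unique (R : realType) (f : R -> R[i]) (x : R) (d e : R[i]) :
  is_cderive f x d -> is_cderive f x e -> d = e.
Proof.
by move: d e => [d1 d2] [e1 e2] [[_ /= <-] [_ /= <-]] [[_ /= <-] [_ /= <-]].
Qed.

Lemma near_eq_is_cderive (R : realType) (f g : R -> R[i]) (x : R) (d : R[i]) :
  (\near x, f x = g x) -> is_cderive f x d -> is_cderive g x d.
Proof.
by move=> fg [fRe fIm]; split;
  [apply: near_eq_is_derive fRe|apply: near_eq_is_derive fIm];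
  apply: filterS fg => u ->.
Qed.

Lemma is_cderive_cst (R : realType) (c : R[i]) (x : R) :
  is_cderive (fun=> c) x 0.
Proof. by split => /=; exact: is_derive_cst. Qed.

Lemma is_cderiveD (R : realType) (f g : R -> R[i]) (x : R) (df dg : R[i]) :
  is_cderive f x df -> is_cderive g x dg ->
  is_cderive (fun u => f u + g u) x (df + dg).
Proof.
move=> [fRe fIm] [gRe gIm]; split.
- under eq_fun do rewrite ReD.
  by rewrite ReD; exact: is_deriveD.
- under eq_fun do rewrite ImD.
  by rewrite ImD; exact: is_deriveD.
Qed.

Lemma is_cderiveM (R : realType) (f g : R -> R[i]) (x : R) (df dg : R[i]) :
  is_cderive f x df -> is_cderive g x dg ->
  is_cderive (fun u => f u * g u) x (df * g x + f x * dg).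
Proof.
move=> [fRe fIm] [gRe gIm]; split.
- under eq_fun do rewrite ReM.
  apply: (is_derive_eq (is_deriveB (is_deriveM fRe gRe) (is_deriveM fIm gIm))).
  rewrite ReD !ReM /GRing.scale/=; ring.
- under eq_fun do rewrite ImM.
  apply: (is_derive_eq (is_deriveD (is_deriveM fRe gIm) (is_deriveM fIm gRe))).
  rewrite ImD !ImM /GRing.scale/=; ring.
Qed.

Lemma is_cderive_sum (R : realType) (I : Type) (r : seq I)
    (f : I -> R -> R[i]) (x : R) (df : I -> R[i]) :
  (forall i, is_cderive (f i) x (df i)) ->
  is_cderive (fun u => \sum_(i <- r) f i u) x (\sum_(i <- r) df i).
Proof.
move=> fdf; elim: r => [|i r IHr].
  by under eq_fun do rewrite big_nil; rewrite big_nil; exact: is_cderive_cst.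
under eq_fun do rewrite big_cons.
by rewrite big_cons; exact: is_cderiveD.
Qed.

Definition cderivable (R : realType) (f : R -> R[i]) (x : R) : Prop :=
  exists d, is_cderive f x d.

Lemma cderivable_cst (R : realType) (c : R[i]) (x : R) :
  cderivable (fun=> c) x.
Proof. by exists 0; exact: is_cderive_cst. Qed.

Lemma cderivableM (R : realType) (f g : R -> R[i]) (x : R) :
  cderivable f x -> cderivable g x -> cderivable (fun u => f u * g u) x.
Proof.
move=> [df fdf] [dg gdg].
by exists (df * g x + f x * dg); exact: is_cderiveM.
Qed.

Lemma cderivable_sum (R : realType) (I : Type) (r : seq I)
    (f : I -> R -> R[i]) (x : R) :
  (forall i, cderivable (f i) x) ->
  cderivable (fun u => \sum_(i <- r) f i u) x.
Proof.
move=> /choice[df fdf].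
by exists (\sum_(i <- r) df i); exact: is_cderive_sum.
Qed.

Lemma cderivable_prod (R : realType) (I : Type) (r : seq I)
    (f : I -> R -> R[i]) (x : R) :
  (forall i, cderivable (f i) x) ->
  cderivable (fun u => \prod_(i <- r) f i u) x.
Proof.
move=> fdf; elim: r => [|i r IHr].
  by under eq_fun do rewrite big_nil; exact: cderivable_cst.
by under eq_fun do rewrite big_cons; exact: cderivableM.
Qed.

Lemma derivable_cderivable (R : realType) (f : R -> R[i]) (p q : R -> R)
    (x : R) :
  (forall u, f u = p u +i* q u) ->
  derivable p x 1 -> derivable q x 1 -> cderivable f x.
Proof.
move=> fE dp dq; have -> : f = fun u => p u +i* q u by exact/funext.
exists ('D_1 p x +i* 'D_1 q x); split.
- change (is_derive x 1 p ('D_1 p x)); exact: DeriveDef dp erefl.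
- change (is_derive x 1 q ('D_1 q x)); exact: DeriveDef dq erefl.
Qed.

(** The inverse is the conjugate over the squared modulus, so both of its parts are real quotients
    with denominator [N], a sum of two squares that vanishes only where [f] does. *)
Lemma cderivableV (R : realType) (f : R -> R[i]) (x : R) :
  f x != 0 -> cderivable f x -> cderivable (fun u => (f u)^-1) x.
Proof.
move=> fx0 [df [[dRe _] [dIm _]]].
pose r (u : R) : R := complex.Re (f u).
pose i (u : R) : R := complex.Im (f u).
pose N : R -> R := r * r + i * i.
have Nx : N x != 0.
  apply: contraNneq fx0 => Nx0; have /andP[] : (r x == 0) && (i x == 0).
    rewrite -(sqrf_eq0 (r x)) -(sqrf_eq0 (i x)) -paddr_eq0 ?sqr_ge0//.
    by rewrite -Nx0.
  by rewrite eq_complex => -> ->.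
have dN := derivableD (derivableM dRe dRe) (derivableM dIm dIm).
have dV := derivableV Nx dN.
have dvRe := derivableM dRe dV.
have dvIm := derivableM (derivableN dIm) dV.
apply: (derivable_cderivable _ dvRe dvIm) => u.
by rewrite /N /r /i !fctE; case: (f u) => p q; rewrite /= mulNr -!expr2.
Qed.

Lemma cderivable_det (R : realType) (n : nat) (A : R -> 'M[R[i]]_n) (x : R) :
  (forall i j, cderivable (fun u => A u i j) x) ->
  cderivable (fun u => \det (A u)) x.
Proof.
move=> dA; rewrite /determinant; apply: cderivable_sum => s.
by apply: cderivableM; [exact: cderivable_cst|exact: cderivable_prod].
Qed.

(** * Biorthogonal systems of polynomials *)

(** The linear functional sending ['X^j] to [f j]; [bimomf M] is then the bilinear form with Gram
    matrix [M] on the monomials. *)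
Definition momf (F : comNzRingType) (f : nat -> F) (p : {poly F}) : F :=
  \sum_(j < size p) p`_j * f j.

Definition bimomf (F : comNzRingType) (M : nat -> nat -> F) (p q : {poly F}) :
    F :=
  momf (fun j => momf (M j) q) p.

(** The range [size p] moves with [p]; a common bound is what allows sums of polynomials and
    termwise differentiation. *)
Lemma momfE (F : comNzRingType) (f : nat -> F) (p : {poly F}) (n : nat) :
  (size p <= n)%N -> momf f p = \sum_(j < n) p`_j * f j.
Proof.
move=> pn; rewrite /momf (big_ord_widen_cond n xpredT (fun j => p`_j * f j))//.
rewrite [RHS](bigID (fun j : 'I_n => (j < size p)%N))/=.
rewrite [X in _ = _ + X]big1 ?addr0// => j.
by rewrite -leqNgt => pj; rewrite nth_default// mul0r.
Qed.

Lemma momfD (F : comNzRingType) (f : nat -> F) (p q : {poly F}) :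
  momf f (p + q) = momf f p + momf f q.
Proof.
pose n := maxn (size p) (size q).
rewrite !(@momfE _ _ _ n) ?leq_maxl ?leq_maxr ?size_polyD//.
by rewrite -big_split; apply: eq_bigr => j _; rewrite coefD mulrDl.
Qed.

Lemma momfZ (F : comNzRingType) (f : nat -> F) (c : F) (p : {poly F}) :
  momf f (c *: p) = c * momf f p.
Proof.
rewrite !(@momfE _ _ _ (size p)) ?size_scale_leq// mulr_sumr.
by apply: eq_bigr => j _; rewrite coefZ mulrA.
Qed.

Lemma momf_sum (F : comNzRingType) (f : nat -> F) (n : nat) (c : nat -> F)
    (P : nat -> {poly F}) :
  momf f (\sum_(l < n) c l *: P l) = \sum_(l < n) c l * momf f (P l).
Proof.
elim: n => [|n IHn]; first by rewrite !big_ord0 /momf size_poly0 big_ord0.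
by rewrite !big_ord_recr/= momfD IHn momfZ.
Qed.

Lemma momf_linear_sum (F : comNzRingType) (m : nat) (c : nat -> F)
    (f : nat -> nat -> F) (p : {poly F}) :
  momf (fun j => \sum_(k < m) c k * f j k) p =
  \sum_(k < m) c k * momf (f^~ k) p.
Proof.
rewrite /momf; under eq_bigr do rewrite mulr_sumr.
rewrite exchange_big; apply: eq_bigr => k _; rewrite mulr_sumr.
by apply: eq_bigr => j _; rewrite mulrCA.
Qed.

Lemma bimomf_tr (F : comNzRingType) (M : nat -> nat -> F) (p q : {poly F}) :
  bimomf (fun j k => M k j) q p = bimomf M p q.
Proof.
rewrite /bimomf.
rewrite [LHS](@momf_linear_sum _ (size p) (fun j => p`_j) (fun k j => M j k)).
by [].
Qed.

Lemma bimomf_sumr (F : comNzRingType) (M : nat -> nat -> F) (n : nat)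
    (c : nat -> F) (p : {poly F}) (Q : nat -> {poly F}) :
  bimomf M p (\sum_(l < n) c l *: Q l) = \sum_(l < n) c l * bimomf M p (Q l).
Proof.
rewrite -bimomf_tr [LHS]momf_sum.
by under eq_bigr do rewrite -/(bimomf _ _ _) bimomf_tr.
Qed.

Lemma bimomf_rank1 (F : comNzRingType) (f g : nat -> F) (p q : {poly F}) :
  bimomf (fun j k => f j * g k) p q = momf f p * momf g q.
Proof.
rewrite [RHS]mulr_suml; apply: eq_bigr => j _; rewrite -mulrA; congr (_ * _).
by rewrite [RHS]mulr_sumr; apply: eq_bigr => k _; rewrite mulrCA.
Qed.

(** The purely algebraic shadow of the problem: the pairing is known only by its moments. The
    determinants serve to solve for the coefficients, and the shared [S] keeps the notion symmetric
    in [P] and [Q]. *)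
Definition biorthogonal_system (F : fieldType) (M : nat -> nat -> F)
    (S : nat -> F) (P Q : nat -> {poly F}) : Prop :=
  [/\ forall n, \det (\matrix_(j < n, k < n) M j k) != 0,
      forall n, size (P n) = n.+1 /\ lead_coef (P n) = S n,
      forall n, size (Q n) = n.+1 /\ lead_coef (Q n) = S n &
      forall m n, bimomf M (P m) (Q n) = (m == n)%:R].

Lemma biorthogonal_system_tr (F : fieldType) (M : nat -> nat -> F)
    (S : nat -> F) (P Q : nat -> {poly F}) :
  biorthogonal_system M S P Q ->
  biorthogonal_system (fun j k => M k j) S Q P.
Proof.
move=> [Mdet hP hQ hPQ]; split => // [n|m n].
- rewrite -det_tr; congr (\det _ != 0): (Mdet n).
  by apply/matrixP => j k; rewrite !mxE.
- by rewrite bimomf_tr hPQ eq_sym.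
Qed.

(** Induction on the degree bound: a multiple of [P n] cancels the coefficient of ['X^n], since the
    size of [P n] makes its own coefficient there nonzero. *)
Lemma poly_graded_basis (F : fieldType) (P : nat -> {poly F}) (n : nat)
    (p : {poly F}) :
  (forall n, size (P n) = n.+1) -> (size p <= n)%N ->
  exists c : nat -> F, p = \sum_(l < n) c l *: P l.
Proof.
move=> hP; elim: n p => [|n IHn] p.
  rewrite leqn0 size_poly_eq0 => /eqP ->.
  by exists (fun=> 0); rewrite big_ord0.
move=> pn; have Pn0 : (P n)`_n != 0.
  by rewrite -[X in _`_X]/(n.+1.-1) -(hP n) lead_coef_eq0 -size_poly_eq0 hP.
have [|c pc] := IHn (p - (p`_n / (P n)`_n) *: P n).
  apply/leq_sizeP => j; rewrite leq_eqVlt => /predU1P[<-|nj].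
    by rewrite coefB coefZ divfK// subrr.
  have pj : p`_j = 0 by rewrite nth_default// (leq_trans pn).
  have Pj : (P n)`_j = 0 by rewrite nth_default// hP.
  by rewrite coefB coefZ pj Pj mulr0 subr0.
exists (fun l => if l == n then p`_n / (P n)`_n else c l).
rewrite big_ord_recr/= eqxx -[LHS](subrK ((p`_n / (P n)`_n) *: P n)) pc.
by congr (_ + _); apply: eq_bigr => l _; rewrite ltn_eqF.
Qed.

Lemma biorthogonal_expansion (F : fieldType) (M : nat -> nat -> F)
    (S : nat -> F) (P Q : nat -> {poly F}) (n : nat) (p : {poly F}) :
  biorthogonal_system M S P Q -> (size p <= n)%N ->
  p = \sum_(l < n) bimomf M p (Q l) *: P l.
Proof.
move=> [_ hP _ hPQ] pn.
have [|c pc] := @poly_graded_basis _ P n p _ pn.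
  by move=> m; case: (hP m).
rewrite {1}pc; apply: eq_bigr => l _; congr (_ *: _).
rewrite pc [RHS]momf_sum (bigD1 l)//= big1 => [|m ml].
  by rewrite -/(bimomf _ _ _) hPQ eqxx mulr1 addr0.
by rewrite -/(bimomf _ _ _) hPQ val_eqE (negPf ml) mulr0.
Qed.

Lemma biorthogonal_lower (F : fieldType) (M : nat -> nat -> F)
    (S : nat -> F) (P Q : nat -> {poly F}) (n : nat) (q : {poly F}) :
  biorthogonal_system M S P Q -> (size q <= n)%N -> bimomf M (P n) q = 0.
Proof.
move=> [_ _ hQ hPQ] qn.
have [|c ->] := @poly_graded_basis _ Q n q _ qn.
  by move=> m; case: (hQ m).
rewrite bimomf_sumr big1// => l _.
by rewrite hPQ gtn_eqF ?mulr0// ltn_ord.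
Qed.

(** In the expansion of [p] only [P n] reaches degree [n], so comparing coefficients of ['X^n]
    isolates the last coordinate. Applied to derivatives, this reduces the diagonal pairings to
    derivatives of leading coefficients. *)
Lemma biorthogonal_top (F : fieldType) (M : nat -> nat -> F)
    (S : nat -> F) (P Q : nat -> {poly F}) (n : nat) (p : {poly F}) :
  biorthogonal_system M S P Q -> (size p <= n.+1)%N ->
  bimomf M p (Q n) = p`_n / S n.
Proof.
move=> sys pn; have [_ hP _ _] := sys; have [Pn PnS] := hP n.
have Sn0 : S n != 0 by rewrite -PnS lead_coef_eq0 -size_poly_eq0 Pn.
apply: (mulIf Sn0); rewrite divfK//.
rewrite [in RHS](biorthogonal_expansion sys pn) big_ord_recr/= coefD coefZ.
rewrite coef_sum big1 ?add0r => [|l _].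
  by rewrite -PnS lead_coefE Pn.
by rewrite coefZ nth_default ?mulr0// (hP l).1.
Qed.

(** Orthogonality of [P n] to ['X^k] for [k < n] is a linear system for the lower coefficients, with
    the leading term moved to the right-hand side. The inverse matrix is spelled out by determinant
    and cofactors so that differentiability in a parameter can be read off. *)
Lemma biorthogonal_cramer (F : fieldType) (M : nat -> nat -> F)
    (S : nat -> F) (P Q : nat -> {poly F}) (n : nat) (j : 'I_n) :
  biorthogonal_system M S P Q ->
  (P n)`_j = \sum_(k < n) - (S n * M n k) *
    ((\det (\matrix_(j < n, k < n) M j k))^-1 *
     cofactor (\matrix_(j < n, k < n) M j k) j k).
Proof.
move=> sys; have [Mdet hP _ _] := sys.
set A := \matrix_(j, k) M j k.
have A_unit : A \in unitmx by rewrite unitmxE unitfE.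
pose u : 'rV[F]_n := \row_j (P n)`_j.
pose v : 'rV[F]_n := \row_k (- (S n * M n k)).
have uA : u *m A = v.
  apply/rowP => k; rewrite !mxE.
  have : bimomf M (P n) 'X^k = 0.
    by apply: (biorthogonal_lower sys); rewrite size_polyXn.
  rewrite /bimomf (@momfE _ _ _ n.+1) ?(hP n).1// big_ord_recr/=.
  have MX i : momf (M i) 'X^k = M i k.
    rewrite (@momfE _ _ _ k.+1) ?size_polyXn// big_ord_recr/= coefXn eqxx mul1r.
    by rewrite big1 ?add0r// => l _; rewrite coefXn ltn_eqF ?mul0r.
  have -> : (P n)`_n = S n by rewrite -(hP n).2 lead_coefE (hP n).1.
  rewrite MX => /eqP; rewrite addr_eq0 => /eqP <-.
  by apply: eq_bigr => i _; rewrite !mxE MX.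
have -> : (P n)`_j = u 0 j by rewrite mxE.
rewrite -(mulmxK A_unit u) uA /invmx A_unit mxE.
by apply: eq_bigr => k _; rewrite !mxE.
Qed.

(** * Rank one deformations of the moments *)

(** The product rule when functional and polynomial both vary; the size bound uniform near [x] fixes
    the range of summation. *)
Lemma is_cderive_momf (R : realType) (f : R -> nat -> R[i])
    (p : R -> {poly R[i]}) (x : R) (n : nat) (df : nat -> R[i])
    (dp : {poly R[i]}) :
  (\forall u \near x, (size (p u) <= n)%N) -> (size dp <= n)%N ->
  (forall j, is_cderive (fun u => f u j) x (df j)) ->
  (forall j, is_cderive (fun u => (p u)`_j) x dp`_j) ->
  is_cderive (fun u => momf (f u) (p u)) x
    (momf (f x) dp + momf df (p x)).
Proof.
move=> pn dpn fdf pdp.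
apply: (@near_eq_is_cderive _ (fun u => \sum_(j < n) (p u)`_j * f u j)).
  by apply: filterS pn => u /momfE ->.
rewrite (momfE _ dpn) (momfE _ (nbhs_singleton pn)) -big_split.
by apply: is_cderive_sum => j; exact: is_cderiveM.
Qed.

(** Below degree [n] the coefficient is given by Cramer's formula, at degree [n] it is [S], and
    above it is zero. *)
Lemma biorthogonal_cderivable (R : realType) (M : R -> nat -> nat -> R[i])
    (S : R -> nat -> R[i]) (P Q : R -> nat -> {poly R[i]}) (x : R) (n j : nat) :
  (forall j k, cderivable (fun u => M u j k) x) ->
  cderivable (S^~ n) x ->
  (\forall u \near x, biorthogonal_system (M u) (S u) (P u) (Q u)) ->
  cderivable (fun u => (P u n)`_j) x.
Proof.
move=> dM dS sys; have [jn|jn|->] := ltngtP j n.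
- have [d fd] : cderivable (fun u => \sum_(k < n) (- 1 * (S u n * M u n k)) *
      ((\det (\matrix_(j < n, k < n) M u j k))^-1 *
       cofactor (\matrix_(j < n, k < n) M u j k) (Ordinal jn) k)) x.
    have dMx : forall i k,
        cderivable (fun u => (\matrix_(j < n, k < n) M u j k) i k) x.
      by move=> i k; under eq_fun do rewrite mxE; exact: dM.
    apply: cderivable_sum => k; apply: cderivableM.
      apply: cderivableM; first exact: cderivable_cst.
      exact: cderivableM.
    apply: cderivableM.
      apply: cderivableV; last exact: cderivable_det.
      by have [+ _ _ _] := nbhs_singleton sys; apply.
    apply: cderivableM; first exact: cderivable_cst.
    apply: cderivable_det => i l; under eq_fun do rewrite 2!mxE.
    exact: dMx.
  exists d; apply: near_eq_is_cderive fd; apply: filterS sys => u sys.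
  rewrite -[j]/(val (Ordinal jn)) (biorthogonal_cramer _ sys).
  by apply: eq_bigr => k _; rewrite mulN1r.
- have [d fd] := cderivable_cst (0 : R[i]) x; exists d.
  apply: near_eq_is_cderive fd; apply: filterS sys => u [_ hP _ _].
  by rewrite nth_default// (hP n).1.
- have [d fd] := dS; exists d.
  apply: near_eq_is_cderive fd; apply: filterS sys => u [_ hP _ _].
  by rewrite -(hP n).2 lead_coefE (hP n).1.
Qed.

(* Differentiating [bimomf M (P n) (Q l) = (n == l)] along a rank one
   deformation of M gives the coordinates of the derivative of P n in the basis
   P 0, ..., P n; the equal leading coefficients of P n and Q n account for the
   factor 1/2 on the diagonal. *)
Lemma biorthogonal_deformation (R : realType) (M : R -> nat -> nat -> R[i])
    (f g : nat -> R[i]) (S : R -> nat -> R[i]) (P Q : R -> nat -> {poly R[i]})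
    (s : R) (n : nat) (x : R[i]) :
  (forall j k, is_cderive (fun u => M u j k) s (f j * g k)) ->
  (forall n, cderivable (S^~ n) s) ->
  (\forall u \near s, biorthogonal_system (M u) (S u) (P u) (Q u)) ->
  is_cderive (fun u => (P u n).[x]) s
    (- momf f (P s n) * (2^-1 * (P s n).[x] * momf g (Q s n) +
       \sum_(l < n) (P s l).[x] * momf g (Q s l))).
Proof.
move=> dM dS sys; have sys_s := nbhs_singleton sys.
have sysT : \forall u \near s,
    biorthogonal_system (fun j k => M u k j) (S u) (Q u) (P u).
  by apply: filterS sys => u; exact: biorthogonal_system_tr.
have dM' j k : cderivable (fun u => M u j k) s by exists (f j * g k); exact: dM.
(* Coefficients from [m.+1] on vanish near [s], so the coefficientwise derivatives assemble into one
   polynomial, which can be paired and expanded like any other. *)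
have dpoly (p : R -> {poly R[i]}) m :
    (\forall u \near s, size (p u) = m.+1) ->
    (forall j, cderivable (fun u => (p u)`_j) s) ->
    exists dp : {poly R[i]}, (size dp <= m.+1)%N /\
      forall j, is_cderive (fun u => (p u)`_j) s dp`_j.
  move=> pm /choice[d pd]; exists (\poly_(j < m.+1) d j).
  split=> [|j]; first exact: size_poly.
  rewrite coef_poly; case: ltnP => // mj.
  apply: near_eq_is_cderive (is_cderive_cst 0 s).
  by apply: filterS pm => u pm; rewrite nth_default// pm.
have szP m : \forall u \near s, size (P u m) = m.+1.
  by apply: filterS sys => u [_ /(_ m)[]].
have szQ m : \forall u \near s, size (Q u m) = m.+1.
  by apply: filterS sys => u [_ _ /(_ m)[]].
have [p' [p'n dP]] : exists dp : {poly R[i]}, (size dp <= n.+1)%N /\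
    forall j, is_cderive (fun u => (P u n)`_j) s dp`_j.
  by apply: dpoly => // j; exact: biorthogonal_cderivable sys.
have dQ m : exists dp : {poly R[i]}, (size dp <= m.+1)%N /\
    forall j, is_cderive (fun u => (Q u m)`_j) s dp`_j.
  apply: dpoly => // j; apply: (biorthogonal_cderivable _ _ _ sysT) => //.
pose B := bimomf (M s).
(* The product rule for the constant [(n == m)%:R]: one term each from [P n], from [Q m] and from
   the array of moments. *)
have dB m (q' : {poly R[i]}) : (size q' <= m.+1)%N ->
    (forall j, is_cderive (fun u => (Q u m)`_j) s q'`_j) ->
    B p' (Q s m) + (B (P s n) q' + momf f (P s n) * momf g (Q s m)) = 0.
  move=> q'm dQm.
  have dN j : is_cderive (fun u => momf (M u j) (Q u m)) s
      (momf (M s j) q' + momf (fun k => f j * g k) (Q s m)).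
    apply: (@is_cderive_momf _ _ _ _ m.+1) => //.
    by apply: filterS (szQ m) => u ->.
  have := @is_cderive_momf _ _ _ _ n.+1 _ _ _ p'n dN dP.
  have : \forall u \near s, (size (P u n) <= n.+1)%N.
    by apply: filterS (szP n) => u ->.
  move=> szPn /(_ szPn) dBm.
  have : is_cderive (fun u => bimomf (M u) (P u n) (Q u m)) s 0.
    apply: near_eq_is_cderive (is_cderive_cst ((n == m)%:R) s).
    by apply: filterS sys => u [_ _ _ ->].
  move=> /(is_cderive_unique dBm) <-; congr (_ + _).
  rewrite -bimomf_rank1 /B /bimomf /momf -big_split.
  by apply: eq_bigr => j _; rewrite mulrDr.
have dPQ : bimomf (M s) p' (Q s n) =
    - (2^-1 * (momf f (P s n) * momf g (Q s n))).
  have [q' [q'n dQn]] := dQ n; have := dB n q' q'n dQn.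
  (* Each side is the derivative of [S n] divided by [S n]: the pairings see only leading
     coefficients, and those of [P n] and [Q n] agree near [s]. *)
  have -> : B (P s n) q' = B p' (Q s n).
    rewrite /B (biorthogonal_top sys_s)// -(bimomf_tr _ (P s n)).
    rewrite (biorthogonal_top (biorthogonal_system_tr sys_s))//.
    congr (_ / _); apply: (is_cderive_unique (dQn n)).
    apply: near_eq_is_cderive (dP n).
    apply: filterS sys => u [_ hP hQ _].
    have [Pn PS] := hP n; have [Qn QS] := hQ n.
    have -> : (P u n)`_n = S u n by rewrite -PS lead_coefE Pn.
    by rewrite -QS lead_coefE Qn.
  rewrite addrA -mulr2n => /eqP; rewrite addr_eq0 => /eqP Bpq.
  have two_neq0 : 2 != 0 :> R[i] by rewrite pnatr_eq0.
  by apply: (mulfI two_neq0); rewrite mulr_natl Bpq mulrN mulVKf.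
have dPl (l : 'I_n) : bimomf (M s) p' (Q s l) =
    - (momf f (P s n) * momf g (Q s l)).
  have [q' [q'l dQl]] := dQ l; have /eqP := dB l q' q'l dQl.
  (* [q'] has size at most [l.+1 <= n], hence is orthogonal to [P s n]. *)
  rewrite [B (P s n) q'](biorthogonal_lower sys_s) ?(leq_trans q'l)//.
  by rewrite add0r addr_eq0 => /eqP.
have -> : - momf f (P s n) * (2^-1 * (P s n).[x] * momf g (Q s n) +
    \sum_(l < n) (P s l).[x] * momf g (Q s l)) = p'.[x].
  rewrite (biorthogonal_expansion sys_s p'n) big_ord_recr/= dPQ.
  rewrite hornerD hornerZ horner_sum addrC mulrDr; congr (_ + _); last by ring.
  rewrite mulr_sumr; apply: eq_bigr => l _; rewrite hornerZ dPl; ring.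
rewrite (horner_coef_wide _ p'n).
apply: (@near_eq_is_cderive _ (fun u => \sum_(j < n.+1) (P u n)`_j * x ^+ j)).
  by apply: filterS (szP n) => u Pn; rewrite horner_coef Pn.
apply: is_cderive_sum => j; rewrite -[X in is_cderive _ _ X]addr0.
rewrite -[X in _ + X](mulr0 ((P s n)`_j)).
exact: is_cderiveM (dP j) (is_cderive_cst _ _).
Qed.

(** * Truncated Cauchy pairings *)

Lemma measurable_half_line (R : realType) :
  measurable (@half_line R : set (measurableTypeR R)).
Proof.
suff : measurable (`]0, +oo[%classic : set R).
  suff -> : half_line (R:=R) = `]0, +oo[%classic by [].
  by apply/seteqP; split => x; rewrite /= in_itv/= andbT.
exact: measurable_itv.
Qed.

(** The integrands differ by the factor [h y = (x0 + y) / (x + y)], bounded by [x0 / x + 1] because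
    [x0 / (x + y) <= x0 / x] and [y / (x + y) <= 1]. *)
Lemma stieltjes_integrable (R : realType) (w : R -> R) (x0 x : R) :
  0 < x0 -> 0 < x ->
  lebesgue_measure.-integrable (@half_line R) (fun y => (w y / (x0 + y))%:E) ->
  lebesgue_measure.-integrable (@half_line R) (fun y => (w y / (x + y))%:E).
Proof.
move=> x0_gt0 x_gt0 wx0.
pose h (y : R) := (x0 + y) / (x + y).
have mh : measurable_fun (@half_line R : set (measurableTypeR R)) h.
  suff : measurable_fun (@half_line R) h by [].
  apply: open_continuous_measurable_fun => [|y]; first exact: open_gt.
  rewrite inE => /= y0; apply: cvgM.
    by apply: cvgD; [exact: cvg_cst|exact: cvg_id].
  apply: cvgV; first by rewrite gt_eqF// addr_gt0.
  by apply: cvgD; [exact: cvg_cst|exact: cvg_id].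
have bh : [bounded h y | y in @half_line R].
  exists (x0 / x + 1); split; first exact: num_real.
  move=> M hM y /= y0; have xy : 0 < x + y by rewrite addr_gt0.
  rewrite gtr0_norm ?divr_gt0 ?addr_gt0//; apply: (le_trans _ (ltW hM)).
  rewrite ler_pdivrMr// mulrDr mulrDl mul1r divfK ?gt_eqF//.
  have : 0 <= (x0 / x + 1) * y by rewrite mulr_ge0 ?addr_ge0 ?divr_ge0 ?ltW.
  have := mulr_ge0 (divr_ge0 (ltW x0_gt0) (ltW x_gt0)) (ltW y0).
  lra.
have mD := @measurable_half_line R.
apply: (eq_integrable mD _ _ _ (integrableMl mD wx0 mh bh)) => y.
rewrite inE => /= y0; rewrite /h -EFinM mulrA divfK//.
by rewrite gt_eqF// addr_gt0.
Qed.

(** The difference of the integrands at [x0] and [x] is [(x - x0) / (x + y)] times the integrand at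
    [x0], and [1 / (x + y) <= 2 / x0] once [x > x0 / 2]. This is a Lipschitz estimate at [x0] with
    constant [2 / x0 * C]. *)
Lemma stieltjes_continuous (R : realType) (w : R -> R) (x0 : R) : 0 < x0 ->
  lebesgue_measure.-integrable (@half_line R) (fun y => (w y / (x0 + y))%:E) ->
  {for x0, continuous (fun x =>
     \int[lebesgue_measure]_(y in @half_line R) (w y / (x + y)))}.
Proof.
move=> x0_gt0 wx0; have mD := @measurable_half_line R.
pose C := \int[lebesgue_measure]_(y in @half_line R) `|w y / (x0 + y)|.
have C_ge0 : 0 <= C by exact: Rintegral_ge0.
(* The added 1 allows division by the constant even when [C = 0]. *)
have K_gt0 : 0 < 2 / x0 * C + 1.
  by rewrite ltr_wpDl// mulr_ge0// divr_ge0// ltW.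
apply/cvgrPdist_le => e e_gt0; near=> x.
have x_gt : x0 / 2 < x by near: x; apply: lt_nbhsr; lra.
have x_gt0 : 0 < x by apply: lt_trans x_gt; rewrite divr_gt0.
have xe : `|x0 - x| < e / (2 / x0 * C + 1).
  by near: x; exists (e / (2 / x0 * C + 1)) => //=; rewrite divr_gt0.
have wx := stieltjes_integrable x0_gt0 x_gt0 wx0.
rewrite -RintegralB//; apply: le_trans (le_normr_Rintegral _ _) _ => //.
  apply: (eq_integrable mD _ _ _ (integrableB mD wx0 wx)) => y _.
  by rewrite /= EFinB.
apply: (@le_trans _ _ (`|x0 - x| * (2 / x0) * C)); last first.
  rewrite -mulrA; apply: (@le_trans _ _ (`|x0 - x| * (2 / x0 * C + 1))).
    by rewrite ler_wpM2l// lerDl.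
  by rewrite -ler_pdivlMr// ltW.
have wn : lebesgue_measure.-integrable (@half_line R)
    (EFin \o (fun y => `|w y / (x0 + y)|)) by exact: integrable_norm.
rewrite /C -RintegralZl//; apply: le_Rintegral => //.
- apply: integrable_norm.
  apply: (eq_integrable mD _ _ _ (integrableB mD wx0 wx)) => y _.
  by rewrite /= EFinB.
- exact: eq_integrable mD _ _ _ (integrableZl mD (`|x0 - x| * (2 / x0)) wn).
move=> y /= y0.
have xy_gt0 : 0 < x + y by rewrite addr_gt0.
have x0y_gt0 : 0 < x0 + y by rewrite addr_gt0.
have -> : w y / (x0 + y) - w y / (x + y) =
    (x - x0) / (x + y) * (w y / (x0 + y)).
  by field; rewrite !gt_eqF.
rewrite normrM ler_wpM2r// normrM (distrC x) ler_wpM2l//.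
rewrite gtr0_norm ?invr_gt0// -[2 / x0]invf_div lef_pV2 ?posrE ?divr_gt0//.
by apply: ltW; rewrite ltr_wpDr// ltW.
Unshelve. all: by end_near. Qed.

(* Only differences of the truncated integrals are integrals of [psi]: the
   common part [phi] may fail to be integrable at infinity. *)
Lemma is_derive_truncated_integral (R : realType) (phi psi : R -> R) (s : R) :
  0 < s -> {for s, continuous psi} ->
  (\forall u \near s, lebesgue_measure.-integrable (@half_line R)
     (fun x => (phi x - (u < x)%R%:R * psi x)%:E)) ->
  is_derive s 1 (fun u => \int[lebesgue_measure]_(x in @half_line R)
     (phi x - (u < x)%R%:R * psi x)) (psi s).
Proof.
move=> s_gt0 psi_s [d /= d_gt0 int_near]; have mD := @measurable_half_line R.
pose I u := \int[lebesgue_measure]_(x in @half_line R)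
  (phi x - (u < x)%R%:R * psi x).
(* Half of this radius keeps [[s1, s2]] both where the integrals converge and inside the positive
   half-line. *)
pose d' := Num.min d s.
have d'_gt0 : 0 < d' by rewrite lt_min d_gt0.
pose s1 := s - d' / 2; pose s2 := s + d' / 2.
have int_u u : s1 <= u <= s2 -> lebesgue_measure.-integrable (@half_line R)
     (fun x => (phi x - (u < x)%R%:R * psi x)%:E).
  move=> /andP[s1u us2]; apply: int_near; rewrite /ball_/= ltr_norml.
  have d'd : d' <= d by rewrite ge_min lexx.
  by rewrite /s1 /s2 in s1u us2; apply/andP; split; lra.
have s1s : s1 < s by rewrite /s1; lra.
have ss2 : s < s2 by rewrite /s2; lra.
have s1_gt0 : 0 < s1.
  have : d' <= s by rewrite ge_min lexx orbT.
  by rewrite /s1; lra.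
have diff u : s1 <= u <= s2 ->
    lebesgue_measure.-integrable `]s1, u] (EFin \o psi) /\
    I u - I s1 = \int[lebesgue_measure]_(x in `]s1, u]) psi x.
  move=> /andP[s1u us2].
  have iu : lebesgue_measure.-integrable (@half_line R)
      (fun x => (phi x - (u < x)%R%:R * psi x)%:E) by apply: int_u; rewrite s1u.
  have i1 : lebesgue_measure.-integrable (@half_line R)
      (fun x => (phi x - (s1 < x)%R%:R * psi x)%:E).
    by apply: int_u; rewrite lexx (le_trans s1u).
  (* Raising the truncation point from [s1] to [u] stops the subtraction of [psi] on []s1, u]];
     hence the positive sign of the derivative. *)
  have E x : (phi x - (u < x)%R%:R * psi x) -
      (phi x - (s1 < x)%R%:R * psi x) = (psi \_ `]s1, u]) x.
    rewrite patchE; case: ifPn => [/[1!inE]/=|/negP/[1!inE]/=];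
      rewrite in_itv/=.
      by move=> /andP[-> xu]; rewrite ltNge xu/= mul0r mul1r; ring.
    move=> /negP; rewrite negb_and -leNgt -ltNge => /orP[xs1|ux].
      by rewrite ltNge (le_trans xs1 s1u) ltNge xs1 subrr.
    by rewrite ux (le_lt_trans s1u ux) subrr.
  have sub : `]s1, u] `<=` @half_line R.
    by move=> x /=; rewrite in_itv/= => /andP[/(lt_trans s1_gt0)].
  have idiff : lebesgue_measure.-integrable (@half_line R)
      (EFin \o (psi \_ `]s1, u])).
    apply: (eq_integrable mD _ _ _ (integrableB mD iu i1)) => x _.
    by rewrite /= -E EFinB.
  split.
    have := integrableS mD (measurable_itv _) sub idiff.
    apply: eq_integrable => //.
    by move=> x xs; rewrite /= patchE xs.
  rewrite /I -RintegralB//; under eq_Rintegral do rewrite E.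
  by rewrite -Rintegral_mkcondr setIidr.
(* Integrability up to [s2] leaves room to the right of [s], as a two-sided derivative requires. *)
have [//|i2 _] := diff s2; first by rewrite lexx (ltW (lt_trans s1s ss2)).
have [||dF dFE] := @continuous_FTC1 R psi (BRight s1) s s2 ss2 i2.
- by rewrite lte_fin.
- exact: psi_s.
apply: (@near_eq_is_derive _ _ _ (fun u => I s1 +
    \int[lebesgue_measure]_(x in `]s1, u]) psi x)).
  near=> u; rewrite -(diff u _).2; first by rewrite addrC subrK.
  apply/andP; split; apply: ltW; near: u.
  - exact: lt_nbhsr.
  - exact: lt_nbhsl.
rewrite -[psi s]add0r; apply: is_deriveD.
by rewrite -dFE derive1E; exact: DeriveDef.
Unshelve. all: by end_near. Qed.

(** * Fubini's theorem on the open quadrant *)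

Lemma quadrantE (R : realType) :
  @quadrant R = @half_line R `*` @half_line R.
Proof. by []. Qed.

Lemma measurable_quadrant (R : realType) :
  measurable (@quadrant R : set (measurableTypeR R * measurableTypeR R)).
Proof.
by rewrite quadrantE; apply: measurableX; exact: measurable_half_line.
Qed.

(** Fubini's theorem is applied on the whole plane to the extension by zero, which splits into one
    extension by zero per variable. *)
Lemma restrict_quadrant (R : realType) (f : R * R -> \bar R) (x y : R) :
  (f \_ (@quadrant R)) (x, y) =
  ((fun x' => ((fun y' => f (x', y')) \_ (@half_line R)) y)
     \_ (@half_line R)) x.
Proof.
rewrite !patchE quadrantE in_setX/=.
by case: (x \in _); case: (y \in _).
Qed.

Lemma ae_integrable_quadrant (R : realType) (f : R * R -> R) :
  (lebesgue_measure \x lebesgue_measure)%E.-integrable (@quadrant R)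
    (EFin \o f) ->
  {ae lebesgue_measure, forall x, @half_line R x ->
    lebesgue_measure.-integrable (@half_line R) (fun y => (f (x, y))%:E)}.
Proof.
move=> /(integrable_mkcond _ (@measurable_quadrant R)) /ae_integrable1.
apply: filterS => x fx x_gt0.
apply/(integrable_mkcond _ (@measurable_half_line R)).
apply: (eq_integrable measurableT _ _ _ fx) => y _.
by rewrite restrict_quadrant patchE mem_set.
Qed.

(** Integrability of every slice makes the extended-real inner integral finite everywhere, so it
    coincides pointwise with the real-valued [F]; at an infinite slice [fine] would return 0
    instead. *)
Lemma Rintegral_quadrant (R : realType) (f : R * R -> R) :
  (lebesgue_measure \x lebesgue_measure)%E.-integrable (@quadrant R)
    (EFin \o f) ->
  (forall x, 0 < x ->
    lebesgue_measure.-integrable (@half_line R) (fun y => (f (x, y))%:E)) ->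
  let F x := \int[lebesgue_measure]_(y in @half_line R) f (x, y) in
  lebesgue_measure.-integrable (@half_line R) (EFin \o F) /\
  \int[(lebesgue_measure \x lebesgue_measure)%E]_(p in @quadrant R) f p =
  \int[lebesgue_measure]_(x in @half_line R) F x.
Proof.
move=> /(integrable_mkcond _ (@measurable_quadrant R)) fQ fx F.
have FE : fubini_F lebesgue_measure ((EFin \o f) \_ (@quadrant R)) =
    (EFin \o F) \_ (@half_line R).
  apply/funext => x; rewrite /fubini_F.
  under eq_integral do rewrite restrict_quadrant.
  rewrite patchE; case: ifPn => [x_gt0|xN].
    under eq_integral do rewrite patchE x_gt0.
    rewrite -integral_mkcond /= /F /Rintegral fineK//.
    apply: integrable_fin_num; first exact: measurable_half_line.
    by apply: fx; rewrite inE in x_gt0.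
  under eq_integral do rewrite patchE (negPf xN).
  by rewrite integral0.
split.
  apply/(integrable_mkcond _ (@measurable_half_line R)).
  by rewrite -FE; exact: integrable_fubini_F fQ.
rewrite /Rintegral [in LHS]integral_mkcond [in RHS]integral_mkcond -FE.
by congr fine; rewrite -(integral12_prod_meas1 fQ).
Qed.

(** Both iterated integrals compute the double integral, and swapping the coordinates exchanges
    their order. *)
Lemma integrable_quadrant_swap (R : realType) (f : R * R -> R) :
  (lebesgue_measure \x lebesgue_measure)%E.-integrable (@quadrant R)
    (EFin \o f) ->
  (lebesgue_measure \x lebesgue_measure)%E.-integrable (@quadrant R)
    (EFin \o (f \o swap_pair)) /\
  \int[(lebesgue_measure \x lebesgue_measure)%E]_(p in @quadrant R)
    f (swap_pair p) =
  \int[(lebesgue_measure \x lebesgue_measure)%E]_(p in @quadrant R) f p.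
Proof.
move=> /(integrable_mkcond _ (@measurable_quadrant R)) fQ.
have mf := measurable_int _ fQ.
have E : (EFin \o (f \o swap_pair)) \_ (@quadrant R) =
    ((EFin \o f) \_ (@quadrant R)) \o swap_pair.
  by apply/funext => -[x y]; rewrite /= !patchE !quadrantE !in_setX/= andbC.
have fsQ : (lebesgue_measure \x lebesgue_measure)%E.-integrable setT
    ((EFin \o (f \o swap_pair)) \_ (@quadrant R)).
  apply/integrable12ltyP.
    by rewrite E; apply: measurableT_comp => //; exact: measurable_swap.
  by rewrite E; exact/(integrable21ltyP _ _ mf).
split; first exact/(integrable_mkcond _ (@measurable_quadrant R)).
rewrite /Rintegral; congr fine; rewrite integral_mkcond [RHS]integral_mkcond.
by rewrite -(integral12_prod_meas1 fsQ) -(integral21_prod_meas1 fQ) E.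
Qed.

(** The interval []0, s[] has measure [s > 0], too large for the exceptional null set. *)
Lemma ae_exists_below (R : realType) (P : R -> Prop) (s : R) : 0 < s ->
  {ae lebesgue_measure, forall x, P x} -> exists x, [/\ 0 < x, x < s & P x].
Proof.
move=> s_gt0 [N [mN N0 PN]]; apply/not_existsP => noP.
have sub : `]0, s[%classic `<=` N.
  move=> x /=; rewrite in_itv/= => /andP[x_gt0 xs]; apply: PN => Px.
  by apply: (noP x).
have : (lebesgue_measure (`]0%R, s[%classic : set R) <= lebesgue_measure N)%E.
  by apply: le_measure => //; rewrite inE//; exact: measurable_itv.
rewrite N0 lebesgue_measure_itv/= lte_fin s_gt0 oppr0 adde0 lee_fin.
by rewrite leNgt s_gt0.
Qed.

(** * Complex integrals and the Stieltjes transform *)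

Definition stieltjes (R : realType) (w : R -> R[i]) (x : R) : R[i] :=
  cintegral lebesgue_measure (@half_line R) (fun y => w y / (x + y)%:C).

Lemma ReZr (R : realType) (z : R[i]) (r : R) :
  complex.Re (z * r%:C) = complex.Re z * r.
Proof. by rewrite ReM mulr0 subr0. Qed.

Lemma ImZr (R : realType) (z : R[i]) (r : R) :
  complex.Im (z * r%:C) = complex.Im z * r.
Proof. by rewrite ImM mulr0 add0r. Qed.

Lemma Re_divr (R : realType) (z : R[i]) (r : R) :
  complex.Re (z / r%:C) = complex.Re z / r.
Proof. by rewrite -fmorphV ReZr. Qed.

Lemma Im_divr (R : realType) (z : R[i]) (r : R) :
  complex.Im (z / r%:C) = complex.Im z / r.
Proof. by rewrite -fmorphV ImZr. Qed.

Lemma cintegrableM (R : realType) (d : measure_display) (T : measurableType d)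
    (mu : {measure set T -> \bar R}) (D : set T) (c : R[i]) (f : T -> R[i]) :
  measurable D -> cintegrable mu D f -> cintegrable mu D (fun x => c * f x).
Proof.
move=> mD [fRe fIm]; split.
- apply: (eq_integrable mD _ _ _ (integrableB mD
    (integrableZl mD (complex.Re c) fRe) (integrableZl mD (complex.Im c) fIm))).
  by move=> x _; rewrite ReM EFinB !EFinM.
- apply: (eq_integrable mD _ _ _ (integrableD mD
    (integrableZl mD (complex.Re c) fIm) (integrableZl mD (complex.Im c) fRe))).
  by move=> x _; rewrite ImM EFinD !EFinM.
Qed.

Lemma cintegralZ (R : realType) (d : measure_display) (T : measurableType d)
    (mu : {measure set T -> \bar R}) (D : set T) (c : R[i]) (f : T -> R[i]) :
  measurable D -> cintegrable mu D f ->
  cintegral mu D (fun x => c * f x) = c * cintegral mu D f.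
Proof.
move=> mD [fRe fIm].
have iZ (r : R) (g : T -> R) : mu.-integrable D (EFin \o g) ->
    mu.-integrable D (EFin \o (fun x => r * g x)).
  by move=> ig; exact: eq_integrable mD _ _ _ (integrableZl mD r ig).
apply/eqP; rewrite eq_complex ReM ImM /cintegral/=.
apply/andP; split; apply/eqP.
- under eq_Rintegral do rewrite ReM.
  by rewrite RintegralB ?RintegralZl//; exact: iZ.
- under eq_Rintegral do rewrite ImM.
  by rewrite RintegralD ?RintegralZl//; exact: iZ.
Qed.

Lemma cintegrableD (R : realType) (d : measure_display) (T : measurableType d)
    (mu : {measure set T -> \bar R}) (D : set T) (f g : T -> R[i]) :
  measurable D -> cintegrable mu D f -> cintegrable mu D g ->
  cintegrable mu D (fun x => f x + g x).
Proof.
move=> mD [fRe fIm] [gRe gIm]; split.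
- apply: (eq_integrable mD _ _ _ (integrableD mD fRe gRe)) => x _.
  by rewrite ReD.
- apply: (eq_integrable mD _ _ _ (integrableD mD fIm gIm)) => x _.
  by rewrite ImD.
Qed.

Lemma cintegralD (R : realType) (d : measure_display) (T : measurableType d)
    (mu : {measure set T -> \bar R}) (D : set T) (f g : T -> R[i]) :
  measurable D -> cintegrable mu D f -> cintegrable mu D g ->
  cintegral mu D (fun x => f x + g x) = cintegral mu D f + cintegral mu D g.
Proof.
move=> mD [fRe fIm] [gRe gIm]; rewrite /cintegral.
under eq_Rintegral do rewrite ReD.
under [X in _ +i* X = _]eq_Rintegral do rewrite ImD.
by rewrite !RintegralD.
Qed.

Lemma cintegrable_sum (R : realType) (d : measure_display)
    (T : measurableType d) (mu : {measure set T -> \bar R}) (D : set T)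
    (n : nat) (c : 'I_n -> R[i]) (f : 'I_n -> T -> R[i]) :
  measurable D -> (forall j, cintegrable mu D (f j)) ->
  cintegrable mu D (fun x => \sum_(j < n) c j * f j x) /\
  cintegral mu D (fun x => \sum_(j < n) c j * f j x) =
  \sum_(j < n) c j * cintegral mu D (f j).
Proof.
move=> mD; elim: n c f => [|n IHn] c f fi.
  under eq_fun do rewrite big_ord0; rewrite big_ord0; split.
    by split; exact: integrable0.
  by rewrite /cintegral/= /Rintegral integral0.
have [iS IS] := IHn (c \o lift ord_max) (f \o lift ord_max) (fun=> fi _).
have iM := cintegrableM (c ord_max) mD (fi ord_max).
have E x : \sum_(j < n.+1) c j * f j x =
    \sum_(j < n) c (lift ord_max j) * f (lift ord_max j) x +
    c ord_max * f ord_max x.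
  rewrite big_ord_recr/=; congr (_ + _); apply: eq_bigr => j _.
  by have -> : widen_ord (leqnSn n) j = lift ord_max j
    by apply/val_inj; rewrite /= /bump leqNgt ltn_ord.
under eq_fun do rewrite E.
split; first exact: cintegrableD.
rewrite cintegralD// IS cintegralZ// big_ord_recr/=; congr (_ + _).
apply: eq_bigr => j _.
by have -> : widen_ord (leqnSn n) j = lift ord_max j
  by apply/val_inj; rewrite /= /bump leqNgt ltn_ord.
Qed.

Lemma eq_cintegrable (R : realType) (d : measure_display)
    (T : measurableType d) (mu : {measure set T -> \bar R}) (D : set T)
    (f g : T -> R[i]) :
  measurable D -> (forall x, D x -> f x = g x) ->
  cintegrable mu D f -> cintegrable mu D g.
Proof.
move=> mD fg [fRe fIm]; split.
- by apply: (eq_integrable mD _ _ _ fRe) => x; rewrite inE => /fg ->.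
- by apply: (eq_integrable mD _ _ _ fIm) => x; rewrite inE => /fg ->.
Qed.

Lemma eq_cintegral (R : realType) (d : measure_display)
    (T : measurableType d) (mu : {measure set T -> \bar R}) (D : set T)
    (f g : T -> R[i]) :
  (forall x, D x -> f x = g x) -> cintegral mu D f = cintegral mu D g.
Proof.
by move=> fg; congr (_ +i* _); apply: eq_Rintegral => x; rewrite inE => /fg ->.
Qed.

Lemma cintegrable_stieltjes (R : realType) (w : R -> R[i]) (x0 x : R) :
  0 < x0 -> 0 < x ->
  cintegrable lebesgue_measure (@half_line R) (fun y => w y / (x0 + y)%:C) ->
  cintegrable lebesgue_measure (@half_line R) (fun y => w y / (x + y)%:C).
Proof.
move=> x0_gt0 x_gt0 []; rewrite /cintegrable.
under eq_fun do rewrite Re_divr.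
move=> iRe.
under eq_fun do rewrite Im_divr.
move=> iIm.
under eq_fun do rewrite Re_divr.
under [X in _ /\ integrable _ _ X]eq_fun do rewrite Im_divr.
by split; [exact: stieltjes_integrable iRe|exact: stieltjes_integrable iIm].
Qed.

Lemma cintegral_quadrant (R : realType) (c w : R -> R[i]) :
  cintegrable (lebesgue_measure \x lebesgue_measure)%E (@quadrant R)
    (fun p => c p.1 * (w p.2 / (p.1 + p.2)%:C)) ->
  (forall x, 0 < x -> cintegrable lebesgue_measure (@half_line R)
    (fun y => w y / (x + y)%:C)) ->
  cintegrable lebesgue_measure (@half_line R)
    (fun x => c x * stieltjes w x) /\
  cintegral (lebesgue_measure \x lebesgue_measure)%E (@quadrant R)
    (fun p => c p.1 * (w p.2 / (p.1 + p.2)%:C)) =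
  cintegral lebesgue_measure (@half_line R) (fun x => c x * stieltjes w x).
Proof.
move=> [fRe fIm] wx; have mD := @measurable_half_line R.
have cwx x : 0 < x -> cintegrable lebesgue_measure (@half_line R)
    (fun y => c x * (w y / (x + y)%:C)).
  by move=> /wx; exact: cintegrableM.
have [iRe IRe] := Rintegral_quadrant fRe (fun x x0 => (cwx x x0).1).
have [iIm IIm] := Rintegral_quadrant fIm (fun x x0 => (cwx x x0).2).
have E x : half_line x -> cintegral lebesgue_measure (@half_line R)
    (fun y => c x * (w y / (x + y)%:C)) = c x * stieltjes w x.
  by move=> x0; rewrite cintegralZ//; exact: wx.
split; first split.
- by apply: (eq_integrable mD _ _ _ iRe) => x; rewrite inE => /E <-.
- by apply: (eq_integrable mD _ _ _ iIm) => x; rewrite inE => /E <-.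
rewrite {1}/cintegral IRe IIm; congr (_ +i* _).
- by apply: eq_Rintegral => x; rewrite inE => /E <-.
- by apply: eq_Rintegral => x; rewrite inE => /E <-.
Qed.

(** * Differentiating a pairing in its truncation point *)

Definition ccontinuous_at (R : realType) (f : R -> R[i]) (x : R) : Prop :=
  complex.Re (f u) @[u --> x] --> complex.Re (f x) /\
  complex.Im (f u) @[u --> x] --> complex.Im (f x).

Lemma ccontinuous_cst (R : realType) (c : R[i]) (x : R) :
  ccontinuous_at (fun=> c) x.
Proof. by split; exact: cvg_cst. Qed.

Lemma ccontinuousM (R : realType) (f g : R -> R[i]) (x : R) :
  ccontinuous_at f x -> ccontinuous_at g x ->
  ccontinuous_at (fun u => f u * g u) x.
Proof.
move=> [fRe fIm] [gRe gIm]; split.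
- under eq_fun do rewrite ReM.
  by rewrite ReM; apply: cvgB; exact: cvgM.
- under eq_fun do rewrite ImM.
  by rewrite ImM; apply: cvgD; exact: cvgM.
Qed.

Lemma ccontinuous_stieltjes (R : realType) (w : R -> R[i]) (x : R) : 0 < x ->
  cintegrable lebesgue_measure (@half_line R) (fun y => w y / (x + y)%:C) ->
  ccontinuous_at (stieltjes w) x.
Proof.
move=> x_gt0 [].
under eq_fun do rewrite Re_divr.
move=> iRe.
under eq_fun do rewrite Im_divr.
move=> iIm.
have cRe := stieltjes_continuous x_gt0 iRe.
have cIm := stieltjes_continuous x_gt0 iIm.
split.
- have E u : complex.Re (stieltjes w u) =
      \int[lebesgue_measure]_(y in @half_line R) (complex.Re (w y) / (u + y)).
    by apply: eq_Rintegral => y _; rewrite Re_divr.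
  by under eq_fun do rewrite E; rewrite E; exact: cRe.
- have E u : complex.Im (stieltjes w u) =
      \int[lebesgue_measure]_(y in @half_line R) (complex.Im (w y) / (u + y)).
    by apply: eq_Rintegral => y _; rewrite Im_divr.
  by under eq_fun do rewrite E; rewrite E; exact: cIm.
Qed.

(* Absolute convergence of the double integral bounds the inner integral at
   some x0 below the truncation point, where the deformed weight is v x0 != 0;
   this then holds at every x > 0. *)
Lemma cintegrable_inner (R : realType) (v w : R -> R[i]) (theta : R[i])
    (s : R) : 0 < s -> (forall x, 0 < x -> v x != 0) ->
  cintegrable (lebesgue_measure \x lebesgue_measure)%E (@quadrant R)
    (fun p => (1 - theta * (s < p.1)%R%:R) * v p.1 *
              (w p.2 / (p.1 + p.2)%:C)) ->
  forall x, 0 < x -> cintegrable lebesgue_measure (@half_line R)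
    (fun y => w y / (x + y)%:C).
Proof.
move=> s_gt0 v_neq0 [iRe iIm].
have aeRe := ae_integrable_quadrant iRe.
have aeIm := ae_integrable_quadrant iIm.
(* The two parts are combined before a point is chosen, since one [x0] must serve both. It is sought
   below [s] because above [s] the factor [1 - theta] may vanish, and the slice then says nothing
   about [w]. *)
have aeB := @filterI _ _ (ae_filter_ringOfSetsType lebesgue_measure) _ _
  aeRe aeIm.
have [x0 [x0_gt0 x0s Bx0]] := ae_exists_below s_gt0 aeB.
have {iRe iIm Bx0}[iRe iIm] := Bx0.
have {iRe iIm} iv0 : cintegrable lebesgue_measure (@half_line R)
    (fun y => v x0 * (w y / (x0 + y)%:C)).
  apply: (eq_cintegrable (@measurable_half_line R) _
    (conj (iRe _) (iIm _))) => //.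
  by move=> y _; rewrite /= ltNge (ltW x0s)/= mulr0 subr0 mul1r.
have i0 : cintegrable lebesgue_measure (@half_line R)
    (fun y => w y / (x0 + y)%:C).
  have := cintegrableM (v x0)^-1 (@measurable_half_line R) iv0.
  apply: eq_cintegrable; first exact: measurable_half_line.
  by move=> y _; rewrite mulKf// v_neq0.
by move=> x x_gt0; exact: cintegrable_stieltjes i0.
Qed.

Lemma is_cderive_truncated_pairing (R : realType) (v w : R -> R[i])
    (theta : R[i]) (s : R) : 0 < s -> (forall x, 0 < x -> v x != 0) ->
  ccontinuous_at v s ->
  (\forall u \near s,
    cintegrable (lebesgue_measure \x lebesgue_measure)%E (@quadrant R)
      (fun p => (1 - theta * (u < p.1)%R%:R) * v p.1 *
                (w p.2 / (p.1 + p.2)%:C))) ->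
  is_cderive (fun u =>
      cintegral (lebesgue_measure \x lebesgue_measure)%E (@quadrant R)
        (fun p => (1 - theta * (u < p.1)%R%:R) * v p.1 *
                  (w p.2 / (p.1 + p.2)%:C))) s
    (theta * (v s * stieltjes w s)).
Proof.
move=> s_gt0 v_neq0 cv iv.
have iw := cintegrable_inner s_gt0 v_neq0 (nbhs_singleton iv).
have cw := ccontinuous_stieltjes s_gt0 (iw s s_gt0).
pose H x := v x * stieltjes w x.
(* The indicator is written as a real scalar so that it commutes with real and imaginary parts; each
   part then has the shape [phi - indicator * psi], with [psi] the corresponding part of
   [theta * H]. *)
have E u x : (1 - theta * (u < x)%R%:R) * v x * stieltjes w x =
    H x - ((u < x)%R%:R : R)%:C * (theta * H x).
  by rewrite rmorph_nat /H; ring.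
have ReE u x : complex.Re ((1 - theta * (u < x)%R%:R) * v x * stieltjes w x) =
    complex.Re (H x) - (u < x)%R%:R * complex.Re (theta * H x).
  by rewrite E -mulNr ReD -rmorphN mulrC ReZr mulrC mulNr.
have ImE u x : complex.Im ((1 - theta * (u < x)%R%:R) * v x * stieltjes w x) =
    complex.Im (H x) - (u < x)%R%:R * complex.Im (theta * H x).
  by rewrite E -mulNr ImD -rmorphN mulrC ImZr mulrC mulNr.
have [cRe cIm] : ccontinuous_at (fun x => theta * H x) s.
  by apply: ccontinuousM (ccontinuous_cst _ _) (ccontinuousM cv cw).
pose W u x := (1 - theta * (u < x)%R%:R) * v x.
have iW : \forall u \near s,
    cintegrable lebesgue_measure (@half_line R) (fun x => W u x * stieltjes w x)
    /\ cintegral (lebesgue_measure \x lebesgue_measure)%E (@quadrant R)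
         (fun p => W u p.1 * (w p.2 / (p.1 + p.2)%:C)) =
       cintegral lebesgue_measure (@half_line R)
         (fun x => W u x * stieltjes w x).
  by apply: filterS iv => u iu; exact: cintegral_quadrant.
split.
- apply: near_eq_is_derive (is_derive_truncated_integral s_gt0 cRe _).
  + apply: filterS iW => u [_ ->].
    by apply: eq_Rintegral => x _; rewrite ReE.
  + apply: filterS iW => u [[+ _] _].
    by under eq_fun do rewrite ReE; apply.
- apply: near_eq_is_derive (is_derive_truncated_integral s_gt0 cIm _).
  + apply: filterS iW => u [_ ->].
    by apply: eq_Rintegral => x _; rewrite ImE.
  + apply: filterS iW => u [[_ +] _].
    by under eq_fun do rewrite ImE; apply.
Qed.

(** * The deformed Laguerre weights *)

Lemma laguerre_weight_neq0 (R : realType) (c : R[i]) (x : R) : 0 < x ->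
  laguerre_weight c x != 0.
Proof.
move=> x_gt0; have px : x `^ complex.Re c != 0 by rewrite gt_eqF// powR_gt0.
rewrite /laguerre_weight mulf_neq0//; last first.
  by rewrite fmorph_eq0 gt_eqF// expR_gt0.
rewrite eq_complex /= !mulf_eq0 (negPf px)/= negb_and -implybE.
apply/implyP => /eqP cos0; apply/eqP => sin0.
have := cos2Dsin2 (complex.Im c * ln x).
by rewrite cos0 sin0 expr0n addr0 => /eqP; rewrite eq_sym oner_eq0.
Qed.

Lemma ccontinuous_laguerre_weight (R : realType) (c : R[i]) (x : R) : 0 < x ->
  ccontinuous_at (laguerre_weight c) x.
Proof.
move=> x_gt0; apply: ccontinuousM; last first.
  split; last exact: cvg_cst.
  by apply: (cvg_comp _ _ (cvgN cvg_id)); exact: continuous_expR.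
have cpowRx : x' `^ complex.Re c @[x' --> x] --> x `^ complex.Re c.
  have [/derivable1_diffP dpow _] := is_derive1_powR (complex.Re c) x_gt0.
  exact: differentiable_continuous dpow.
have ctheta : complex.Im c * ln x' @[x' --> x] --> complex.Im c * ln x.
  by apply: cvgM; [exact: cvg_cst|exact: continuous_ln].
split; (apply: cvgM => //; apply: (cvg_comp _ _ ctheta)).
- exact: continuous_cos.
- exact: continuous_sin.
Qed.

Lemma ccontinuous_real_monomial (R : realType) (j : nat) (x : R) :
  ccontinuous_at (real_monomial (R := R) j) x.
Proof.
elim: j => [|j IHj].
  rewrite /real_monomial; under eq_fun do rewrite expr0.
  exact: ccontinuous_cst.
rewrite /real_monomial; under eq_fun do rewrite exprS.
apply: ccontinuousM; last exact: IHj.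
by split; [exact: cvg_id|exact: cvg_cst].
Qed.

(** The upper index is inclusive, so [n - 1] leaves exactly the [n] terms [l < n]; for [n = 0] the
    index is the negative integer of the empty sum. *)
Lemma kernel_sum_pred (R : realType) (F G : nat -> R[i] -> R[i]) (n : nat)
    (x y : R[i]) :
  kernel_sum F G (n%:Z - 1) x y = \sum_(l < n) F l x * G l y.
Proof.
case: n => [|n]; first by rewrite big_ord0.
by rewrite intS addrC addKr /= big_mkord.
Qed.

(** * From pairings of polynomials to their moments *)

Lemma pairing_integrandE (R : realType) (w1 w2 f g : R -> R[i]) (p : R * R) :
  pairing_integrand w1 w2 f g p =
  w1 p.1 * f p.1 * (w2 p.2 * g p.2 / (p.1 + p.2)%:C).
Proof. by rewrite /pairing_integrand; ring. Qed.

Lemma pairing_swap (R : realType) (w1 w2 f g : R -> R[i]) :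
  pairing_converges w1 w2 f g ->
  pairing_converges w2 w1 g f /\ pairing w2 w1 g f = pairing w1 w2 f g.
Proof.
move=> [/integrable_quadrant_swap[iRe IRe] /integrable_quadrant_swap[iIm IIm]].
have E p : pairing_integrand w2 w1 g f p =
    pairing_integrand w1 w2 f g (swap_pair p).
  by rewrite /pairing_integrand/= [p.2 + _]addrC; ring.
rewrite /pairing_converges /pairing (_ : pairing_integrand w2 w1 g f =
    pairing_integrand w1 w2 f g \o swap_pair); last exact/funext.
by split; [split|rewrite {2}/cintegral -IRe -IIm].
Qed.

(** The bridge from the integral pairing to the algebraic form; convergence of every moment is what
    permits splitting the integral over monomials. *)
Lemma pairing_poly (R : realType) (w1 w2 : R -> R[i]) (p q : {poly R[i]}) :
  (forall j k, pairing_converges w1 w2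
     (real_monomial (R := R) j) (real_monomial (R := R) k)) ->
  pairing w1 w2 (real_eval p) (real_eval q) = bimomf (bimoment w1 w2) p q.
Proof.
move=> w12; have mQ := @measurable_quadrant R.
pose I j k := pairing_integrand w1 w2 (real_monomial (R := R) j)
  (real_monomial (R := R) k).
have iq (j : 'I_(size p)) := cintegrable_sum
  (fun k : 'I_(size q) => q`_k) mQ (fun k => w12 j k).
have [_ ip] := cintegrable_sum (fun j => p`_j) mQ (fun j => (iq j).1).
transitivity (cintegral (lebesgue_measure \x lebesgue_measure)%E (@quadrant R)
    (fun z => \sum_(j < size p) p`_j * \sum_(k < size q) q`_k * I j k z)).
  apply: eq_cintegral => z _; rewrite /pairing_integrand /real_eval.
  rewrite (horner_coef p) mulr_sumr mulr_suml; apply: eq_bigr => j _.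
  rewrite (horner_coef q) !mulr_sumr; apply: eq_bigr => k _.
  by rewrite /I /pairing_integrand /real_monomial; ring.
by rewrite ip; apply: eq_bigr => j _; rewrite (iq j).2.
Qed.

(** The denominator at [- s] is [- s - y = - (s + y)]; this is the sign that cancels the one in
    [biorthogonal_deformation]. *)
Lemma cauchy_transform_oppr (R : realType) (w : R -> R[i]) (q : {poly R[i]})
    (s : R) :
  (forall k, cintegrable lebesgue_measure (@half_line R)
     (fun y => w y * real_monomial k y / (s + y)%:C)) ->
  cauchy_transform w q (- s%:C) =
  - momf (fun k => stieltjes (fun y => w y * real_monomial k y) s) q.
Proof.
move=> iw; have mD := @measurable_half_line R.
have [_ iq] := cintegrable_sum (fun k : 'I_(size q) => - q`_k) mD
  (fun k => iw k).
transitivity (cintegral lebesgue_measure (@half_line R) (fun y =>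
    \sum_(k < size q) - q`_k * (w y * real_monomial k y / (s + y)%:C))).
  apply: eq_cintegral => y _.
  rewrite horner_coef mulr_sumr; apply: eq_bigr => k _.
  by rewrite -opprD -rmorphD invrN /real_monomial; ring.
by rewrite iq -sumrN; apply: eq_bigr => k _; rewrite mulNr.
Qed.

Lemma is_cderive_bimoment (R : realType) (c theta : R[i]) (w : R -> R[i])
    (s : R) (j k : nat) : 0 < s ->
  (\forall u \near s, pairing_converges (deformed_weight c theta u) w
     (real_monomial (R := R) j) (real_monomial (R := R) k)) ->
  is_cderive (fun u => bimoment (deformed_weight c theta u) w j k) s
    (theta * laguerre_weight c s * s%:C ^+ j *
     stieltjes (fun y => w y * real_monomial k y) s).
Proof.
move=> s_gt0 iw.
(* The monomials are absorbed into the weights; on [x > 0] the product [v] is still continuous and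
   nonvanishing. *)
pose v x := laguerre_weight c x * real_monomial j x.
pose w' y := w y * real_monomial k y.
have E u : pairing_integrand (deformed_weight c theta u) w
      (real_monomial (R := R) j) (real_monomial (R := R) k) =
    (fun p => (1 - theta * (u < p.1)%R%:R) * v p.1 *
              (w' p.2 / (p.1 + p.2)%:C)).
  apply/funext => p; rewrite pairing_integrandE; congr (_ * _).
  by rewrite /deformed_weight /v [RHS]mulrA.
rewrite [X in is_cderive _ _ X](_ : _ = theta * (v s * stieltjes w' s));
  last by rewrite /v /real_monomial; ring.
rewrite /bimoment /pairing; under eq_fun do rewrite E.
apply: is_cderive_truncated_pairing => //.
- move=> x x_gt0; rewrite mulf_neq0 ?laguerre_weight_neq0//.
  by rewrite expf_neq0// fmorph_eq0 gt_eqF.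
- apply: ccontinuousM; first exact: ccontinuous_laguerre_weight.
  exact: ccontinuous_real_monomial.
- by apply: filterS iw => u; rewrite /pairing_converges E.
Qed.

(** The second weight [w] is arbitrary, so the same statement serves the deformation in [s] and,
    with the variables exchanged, the one in [t]. *)
Lemma truncation_deformation (R : realType) (c theta : R[i]) (w : R -> R[i])
    (s : R) (S : R -> nat -> R[i]) (P Q : R -> nat -> {poly R[i]}) (n : nat) :
  0 < s ->
  (\forall u \near s, forall j k, pairing_converges (deformed_weight c theta u)
     w (real_monomial (R := R) j) (real_monomial (R := R) k)) ->
  (forall m, cderivable (S^~ m) s) ->
  (\forall u \near s, biorthogonal_system
     (bimoment (deformed_weight c theta u) w) (S u) (P u) (Q u)) ->
  (forall x, is_cderive (fun u => (P u n).[x]) s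
     (theta * laguerre_weight c s * (P s n).[s%:C] *
      (2^-1 * (P s n).[x] * cauchy_transform w (Q s n) (- s%:C) +
       \sum_(l < n) (P s l).[x] * cauchy_transform w (Q s l) (- s%:C)))) /\
  (forall y, is_cderive (fun u => (Q u n).[y]) s
     (theta * laguerre_weight c s * cauchy_transform w (Q s n) (- s%:C) *
      (2^-1 * (P s n).[s%:C] * (Q s n).[y] +
       \sum_(l < n) (P s l).[s%:C] * (Q s l).[y]))).
Proof.
move=> s_gt0 conv dS sys; set W := theta * laguerre_weight c s.
(* As functionals on polynomials, [f] is [W] times evaluation at [s], and [g] is minus the Cauchy
   transform at [- s]. *)
pose f j : R[i] := W * s%:C ^+ j.
pose g k := stieltjes (fun y => w y * real_monomial k y) s.
have dM j k : is_cderive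
    (fun u => bimoment (deformed_weight c theta u) w j k) s (f j * g k).
  by apply: is_cderive_bimoment => //; apply: filterS conv => u; apply.
have momP p : momf f p = W * p.[s%:C].
  rewrite horner_coef mulr_sumr; apply: eq_bigr => j _.
  by rewrite /f mulrCA.
have momQ q : cauchy_transform w q (- s%:C) = - momf g q.
  apply: cauchy_transform_oppr => k.
  apply: (@cintegrable_inner _ (laguerre_weight c) _ theta s) => //.
    exact: laguerre_weight_neq0.
  (* The row [j = 0] suffices: its factor in [x] is the deformed Laguerre weight alone. *)
  have := nbhs_singleton conv 0%N k.
  rewrite /pairing_converges; congr (cintegrable _ _ _).
  apply/funext => p.
  by rewrite pairing_integrandE /real_monomial expr0 mulr1.
split=> z.
- have := biorthogonal_deformation n z dM dS sys; congr is_cderive.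
  rewrite momP momQ; under [in RHS]eq_bigr do rewrite momQ mulrN.
  by rewrite sumrN; ring.
- have dMT j k : is_cderive
      (fun u => bimoment (deformed_weight c theta u) w k j) s (g j * f k).
    by rewrite mulrC; exact: dM.
  have sysT : \forall u \near s, biorthogonal_system
      (fun j k => bimoment (deformed_weight c theta u) w k j)
      (S u) (Q u) (P u).
    by apply: filterS sys => u; exact: biorthogonal_system_tr.
  have := biorthogonal_deformation n z dMT dS sysT; congr is_cderive.
  rewrite momQ momP; under eq_bigr do rewrite momP mulrCA.
  rewrite -mulr_sumr; under eq_bigr do rewrite mulrC.
  ring.
Qed.

(** * Restriction to one deformation parameter at a time *)

Lemma cdifferentiable2_fst (R : realType) (f : R -> R -> R[i]) (s t : R) :
  cdifferentiable2 f s t -> cderivable (f^~ t) s.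
Proof.
have dpair : differentiable (fun u : R => (u, t)) s.
  by apply: differentiable_pair => //; exact: differentiable_cst.
move=> [fRe fIm].
have /derivable1_diffP dRe := differentiable_comp dpair fRe.
have /derivable1_diffP dIm := differentiable_comp dpair fIm.
by apply: (derivable_cderivable _ dRe dIm) => u /=; case: (f u t).
Qed.

Lemma cdifferentiable2_snd (R : realType) (f : R -> R -> R[i]) (s t : R) :
  cdifferentiable2 f s t -> cderivable (f s) t.
Proof.
have dpair : differentiable (fun u : R => (s, u)) t.
  by apply: differentiable_pair => //; exact: differentiable_cst.
move=> [fRe fIm].
have /derivable1_diffP dRe := differentiable_comp dpair fRe.
have /derivable1_diffP dIm := differentiable_comp dpair fIm.
by apply: (derivable_cderivable _ dRe dIm) => u /=; case: (f s u).
Qed.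

Unset Implicit Arguments.

Theorem proposition4p4 (R : realType) (a b xi psi : R[i])
  (ha : -1 < complex.Re a) (hb : -1 < complex.Re b)
  (U : set (R * R)) (U_open : open U)
  (U_pos : forall s t : R, U (s, t) -> 0 < s /\ 0 < t)
  (S : nat -> R -> R -> R[i]) (P Q : R -> R -> nat -> {poly R[i]})
  (w1 := deformed_weight a xi) (w2 := deformed_weight b psi)
  (M_finite : forall s t : R, U (s, t) -> forall j k : nat,
     pairing_converges (w1 s) (w2 t)
       (real_monomial (R := R) j) (real_monomial (R := R) k))
  (Z_neq0 : forall s t : R, U (s, t) -> forall n : nat,
     bimoment_det (w1 s) (w2 t) n != 0)
  (S_sqr : forall s t : R, U (s, t) -> forall n : nat,
     S n s t ^+ 2 = bimoment_det (w1 s) (w2 t) n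
                    / bimoment_det (w1 s) (w2 t) n.+1)
  (S_diff : forall s t : R, U (s, t) -> forall n : nat,
     cdifferentiable2 (S n) s t)
  (P_size : forall s t : R, U (s, t) -> forall n : nat,
     size (P s t n) = n.+1)
  (Q_size : forall s t : R, U (s, t) -> forall n : nat,
     size (Q s t n) = n.+1)
  (P_lead : forall s t : R, U (s, t) -> forall n : nat,
     lead_coef (P s t n) = S n s t)
  (Q_lead : forall s t : R, U (s, t) -> forall n : nat,
     lead_coef (Q s t n) = S n s t)
  (PQ_biorth : forall s t : R, U (s, t) -> forall m n : nat,
     pairing (w1 s) (w2 t) (real_eval (P s t m)) (real_eval (Q s t n))
     = (m == n)%:R)
  (P_int_neq0 : forall s t : R, U (s, t) -> forall n : nat,
     weighted_integral (w1 s) (P s t n) != 0)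
  (Q_int_neq0 : forall s t : R, U (s, t) -> forall n : nat,
     weighted_integral (w2 t) (Q s t n) != 0)
  (P1 := fun (s t : R) (n : nat) => cauchy_transform (w1 s) (P s t n))
  (Q1 := fun (s t : R) (n : nat) => cauchy_transform (w2 t) (Q s t n)) :
  forall (n : nat) (s t : R), U (s, t) ->
  [/\ forall x : R[i],
        is_cderive (fun s' : R => (P s' t n).[x]) s
          (xi * laguerre_weight a s * (P s t n).[s%:C] *
           (2^-1 * (P s t n).[x] * Q1 s t n (- s%:C)
            + K01 (w2 t) (P s t) (Q s t) (n%:Z - 1) x (- s%:C))),
      forall y : R[i],
        is_cderive (fun s' : R => (Q s' t n).[y]) s
          (xi * laguerre_weight a s * Q1 s t n (- s%:C) *
           (2^-1 * (P s t n).[s%:C] * (Q s t n).[y]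
            + K00 (P s t) (Q s t) (n%:Z - 1) s%:C y)),
      forall x : R[i],
        is_cderive (fun t' : R => (P s t' n).[x]) t
          (psi * laguerre_weight b t * P1 s t n (- t%:C) *
           (2^-1 * (P s t n).[x] * (Q s t n).[t%:C]
            + K00 (P s t) (Q s t) (n%:Z - 1) x t%:C)) &
      forall y : R[i],
        is_cderive (fun t' : R => (Q s t' n).[y]) t
          (psi * laguerre_weight b t * (Q s t n).[t%:C] *
           (2^-1 * P1 s t n (- t%:C) * (Q s t n).[y]
            + K10 (w1 s) (P s t) (Q s t) (n%:Z - 1) (- t%:C) y))].
Proof.
have sys s t : U (s, t) -> biorthogonal_system (bimoment (w1 s) (w2 t))
    (S^~ s ^~ t) (P s t) (Q s t).
  move=> Ust; split=> [n|n|n|m n].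
  - exact: Z_neq0.
  - by rewrite P_size // P_lead.
  - by rewrite Q_size // Q_lead.
  - by rewrite -pairing_poly ?PQ_biorth //; exact: M_finite.
move=> n s t Ust; have [s_gt0 t_gt0] := U_pos s t Ust.
have nearU : nbhs (s, t) U by exact: open_nbhs_nbhs.
have nearUs : \forall u \near s, U (u, t).
  exact: (cvg_pair (@cvg_id _ (nbhs s)) (cvg_cst t) nearU).
have nearUt : \forall u \near t, U (s, u).
  exact: (cvg_pair (cvg_cst s) (@cvg_id _ (nbhs t)) nearU).
have [dPs dQs] : _ /\ _ := truncation_deformation
  (S := fun u m => S m u t) (P := P^~ t) (Q := Q^~ t) n s_gt0
  (filterS (fun u Uu => M_finite u t Uu) nearUs)
  (fun m => cdifferentiable2_fst (S_diff s t Ust m))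
  (filterS (fun u Uu => sys u t Uu) nearUs).
have convT u : U (s, u) -> forall j k, pairing_converges (w2 u) (w1 s)
    (real_monomial (R := R) j) (real_monomial (R := R) k).
  by move=> Uu j k; have [] := pairing_swap (M_finite s u Uu k j).
have sysT u : U (s, u) -> biorthogonal_system (bimoment (w2 u) (w1 s))
    (S^~ s ^~ u) (Q s u) (P s u).
  move=> Uu; have -> : bimoment (w2 u) (w1 s) =
      (fun j k => bimoment (w1 s) (w2 u) k j).
    apply/funext => j; apply/funext => k.
    by have [_] := pairing_swap (M_finite s u Uu k j).
  exact: biorthogonal_system_tr (sys s u Uu).
(* For [t] the truncated weight is [w2 t] and [Q] is the first family, so the two conclusions come
   out in the order [Q], [P]. *)
have [dQt dPt] := truncation_deformation
  (S := fun u m => S m s u) (P := Q s) (Q := P s) n t_gt0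
  (filterS convT nearUt) (fun m => cdifferentiable2_snd (S_diff s t Ust m))
  (filterS sysT nearUt).
split=> z; rewrite ?/K00 ?/K01 ?/K10 kernel_sum_pred.
- exact: dPs.
- exact: dQs.
- have := dPt z; congr is_cderive; congr (_ * (_ + _)); first by ring.
  by apply: eq_bigr => l _; rewrite mulrC.
- have := dQt z; congr is_cderive; congr (_ * (_ + _)).
    by rewrite /P1; ring.
  by apply: eq_bigr => l _; rewrite mulrC.
Qed.
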